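(* Let $p$ be an odd prime, and let $\mathrm{E}_p(X)=\sum_{n=0}^{\infty} a_n X^n\in\mathbb{F}_p[[X]]$ be the reduction modulo $p$ of the Artin-Hasse exponential series. Let $T(X)=\sum_{i=1}^{\infty}X^{p^i}\in\mathbb{F}_p[[X]]$. Then in $\mathbb{F}_p[[X]]$ we have \[ L_{p-1}^{(-T(X))}(X)=\mathrm{E}_p(X)\cdot \sum_{n=0}^{\infty}(-1)^n a_{np}X^{np}, \] and \[ L_{p-1}^{(-T(X))}(X)\cdot T(X)\cdot \sum_{n=0}^{\infty} a_{np}X^{np}=X^p\,\mathrm{E}_p(X). \]
   Context: The Artin-Hasse exponential series is $\mathrm{AH}(X)=\exp\bigl(\sum_{i=0}^{\infty}X^{p^i}/p^i\bigr)\in\mathbb{Q}[[X]]$; its coefficients are $p$-integral, so it can be reduced modulo $p$, giving $\mathrm{E}_p(X)\in\mathbb{F}_p[[X]]$. For a prime $p$, the (generalized) Laguerre polynomial of degree $p-1$ is the polynomial in $\mathbb{F}_p[\alpha,X]$ given by \[ L_{p-1}^{(\alpha)}(X)=\sum_{k=0}^{p-1}\binom{\alpha-1}{p-1-k}\frac{(-X)^k}{k!} \] (the reduction modulo $p$ of the classical $L_{p-1}^{(\alpha)}(X)=\sum_{k=0}^{p-1}\binom{\alpha+p-1}{p-1-k}\frac{(-X)^k}{k!}$). The series $L_{p-1}^{(-T(X))}(X)\in\mathbb{F}_p[[X]]$ is obtained by substituting $\alpha=-T(X)$. *)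

(* Defs.v *)
From HB Require Import structures.
From mathcomp Require Import all_boot all_order all_algebra.
Set Implicit Arguments. Unset Strict Implicit. Unset Printing Implicit Defensive.
Import Order.TTheory GRing.Theory Num.Theory.
Local Open Scope ring_scope.

Definition fps (R : Type) := nat -> R.

Section FPS.
Variable R : comUnitRingType.

Definition fps_add (f g : fps R) : fps R := fun n => f n + g n.
Definition fps_scale (c : R) (f : fps R) : fps R := fun n => c * f n.
Definition fps_mul (f g : fps R) : fps R :=
  fun n => \sum_(i < n.+1) f i * g (n - i)%N.
Definition fps_C (c : R) : fps R := fun n => if n == 0%N then c else 0.
Definition fps_X : fps R := fun n => (n == 1%N)%:R.
Definition fps_pow (f : fps R) (k : nat) : fps R := iter k (fps_mul f) (fps_C 1).
Definition fps_sum (s : seq (fps R)) : fps R := foldr fps_add (fps_C 0) s.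
Definition fps_prod (s : seq (fps R)) : fps R := foldr fps_mul (fps_C 1) s.

Definition fps_binom_am1 (alpha : fps R) (m : nat) : fps R :=
  fps_scale (m`!%:R)^-1
    (fps_prod [seq fps_add alpha (fps_C (- (j.+1)%:R)) | j <- iota 0 m]).

Definition laguerre_pm1 (p : nat) (alpha : fps R) : fps R :=
  fps_sum [seq fps_mul (fps_binom_am1 alpha (p.-1 - k))
                       (fps_scale ((-1) ^+ k / k`!%:R) (fps_pow fps_X k))
          | k <- iota 0 p].

Definition fps_opp (f : fps R) : fps R := fun n => - f n.
End FPS.

(** Artin-Hasse exponential over Q: AH(X) = exp(sum_i X^(p^i)/p^i).
    Its n-th coefficient is sum_{k=0}^n [X^n] (f_n)^k / k!, where f_n is the
    truncation of sum_i X^(p^i)/p^i to degree <= n (higher terms and k > n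
    do not contribute to [X^n]). *)
Definition ah_log_trunc (p n : nat) : {poly rat} :=
  \sum_(i < n.+1 | (p ^ i <= n)%N) ((p ^ i)%:R)^-1 *: 'X^(p ^ i).

Definition ah_coef (p n : nat) : rat :=
  \sum_(k < n.+1) ((ah_log_trunc p n) ^+ k)`_n / (k`!)%:R.

Definition rat_modp (p : nat) (q : rat) : 'F_p :=
  ((numq q)%:~R) / ((denq q)%:~R).

Definition Ep (p : nat) : fps 'F_p := fun n => rat_modp p (ah_coef p n).

Definition Tser (p : nat) : fps 'F_p :=
  fun n => ([exists i : 'I_n.+1, (0 < (i : nat))%N && (p ^ i == n)%N])%:R.

Definition Ep_sub_sign (p : nat) : fps 'F_p :=
  fun m => if (p %| m)%N then (-1) ^+ (m %/ p) * Ep p m else 0.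
Definition Ep_sub (p : nat) : fps 'F_p :=
  fun m => if (p %| m)%N then Ep p m else 0.

(* Main.v *)
(** Let [theta = X d/dX], [S = X + T] and let [E_0] be the part of [E_p] supported
    on exponents divisible by [p].  Over [Q], [theta AH = (sum_i X^(p^i)) AH], so
    mod [p] one has [theta E_p = S E_p].  Rewriting the Laguerre polynomial as
    [L = - sum_(k < p) X^k prod_(k < j < p) (j - T)] and using [T^p = T - X^p] gives
    [theta L = S L] as well.  Since [E_p(X) E_p(-X) = 1], the quotient
    [G = L(X) E_p(-X)] satisfies [theta G = 0], i.e. it is a series in [X^p].
    With [Pi = prod_(0 < j < p) (j - T) = T^(p-1) - 1], so that [T Pi = - X^p],
    the part of [L = E_p G] on exponents divisible by [p] gives [E_0 G = - Pi],
    whence the second identity; the same part of [L(X) L(-X) = G(X) G(-X)]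
    is [Pi^2 + X^p T^(p-2) = - Pi], so [E_0 = G(-X)], which is the first one. *)
Require Import Defs.
From HB Require Import structures.
From mathcomp Require Import all_boot all_order all_algebra all_field.
From mathcomp Require Import boolp ring zify.
Set Implicit Arguments. Unset Strict Implicit. Unset Printing Implicit Defensive.
Import Order.TTheory GRing.Theory Num.Theory.
Local Open Scope ring_scope.

(** * Formal power series as a commutative ring *)

HB.instance Definition _ (R : Type) := gen_eqMixin (fps R).
HB.instance Definition _ (R : Type) := gen_choiceMixin (fps R).

Section FpsRing.
Variable R : comUnitRingType.
Implicit Types f g h : fps R.

Fact fps_addA : associative (@fps_add R).
Proof. by move=> f g h; apply: funext => n; rewrite /fps_add addrA. Qed.

Fact fps_addC : commutative (@fps_add R).
Proof. by move=> f g; apply: funext => n; rewrite /fps_add addrC. Qed.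

Fact fps_add0 : left_id (fps_C 0) (@fps_add R).
Proof. by move=> f; apply: funext => n; rewrite /fps_add /fps_C if_same add0r. Qed.

Fact fps_addN : left_inverse (fps_C 0) (@fps_opp R) (@fps_add R).
Proof.
by move=> f; apply: funext => n; rewrite /fps_add /fps_opp /fps_C if_same addNr.
Qed.

HB.instance Definition _ :=
  GRing.isZmodule.Build (fps R) fps_addA fps_addC fps_add0 fps_addN.

(** A coefficient of a product in degree [n] sees only degrees up to [n], so series can be replaced
    by polynomial truncations and the ring laws imported from [{poly R}]. *)
Lemma fps_mul_poly f g (P Q : {poly R}) n :
    (forall i, (i <= n)%N -> P`_i = f i) -> (forall i, (i <= n)%N -> Q`_i = g i) ->
  fps_mul f g n = (P * Q)`_n.
Proof.
move=> fP gQ; rewrite coefM; apply: eq_bigr => i _.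
by rewrite fP ?gQ ?leq_subr // -ltnS.
Qed.

Let trunc n f : {poly R} := \poly_(i < n.+1) f i.

Let coef_trunc n f i : (i <= n)%N -> (trunc n f)`_i = f i.
Proof. by move=> lein; rewrite coef_poly ltnS lein. Qed.

Fact fps_mulC : commutative (@fps_mul R).
Proof.
move=> f g; apply: funext => n.
rewrite (@fps_mul_poly f g (trunc n f) (trunc n g)) => [|i|i]; try exact: coef_trunc.
by rewrite mulrC -(@fps_mul_poly g f) // => i; apply: coef_trunc.
Qed.

Fact fps_mulA : associative (@fps_mul R).
Proof.
move=> f g h; apply: funext => n.
rewrite (@fps_mul_poly f _ (trunc n f) (trunc n g * trunc n h)) => [|i|i lein].
- rewrite (@fps_mul_poly _ h (trunc n f * trunc n g) (trunc n h)) => [|i lein|i].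
  + by rewrite mulrA.
  + symmetry; apply: fps_mul_poly => j leji;
      by apply: coef_trunc (leq_trans leji lein).
  + exact: coef_trunc.
- exact: coef_trunc.
- symmetry; apply: fps_mul_poly => j leji;
    by apply: coef_trunc (leq_trans leji lein).
Qed.

Fact fps_mul1 : left_id (fps_C 1) (@fps_mul R).
Proof.
move=> f; apply: funext => n; rewrite /fps_mul big_ord_recl /= mul1r subn0.
by rewrite big1 ?addr0 // => i _; rewrite mul0r.
Qed.

Fact fps_mulDl : left_distributive (@fps_mul R) (@fps_add R).
Proof.
move=> f g h; apply: funext => n; rewrite /fps_mul /fps_add -big_split /=.
by apply: eq_bigr => i _; rewrite mulrDl.
Qed.

Fact fps_1neq0 : fps_C 1 != 0 :> fps R.
Proof.
apply/eqP => /(congr1 (fun f : fps R => f 0%N)) /eqP.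
by rewrite /fps_C /= oner_eq0.
Qed.

HB.instance Definition _ := GRing.Zmodule_isComNzRing.Build (fps R)
  fps_mulA fps_mulC fps_mul1 fps_mulDl fps_1neq0.

Lemma fpsP f g : (forall n, f n = g n) -> f = g.
Proof. exact: funext. Qed.

Lemma fps_addE f g : fps_add f g = f + g. Proof. by []. Qed.
Lemma fps_mulE f g : fps_mul f g = f * g. Proof. by []. Qed.
Lemma fps_oppE f : fps_opp f = - f. Proof. by []. Qed.

Lemma fps0E n : (0 : fps R) n = 0.
Proof. by rewrite [LHS]if_same. Qed.

Lemma fps1E n : (1 : fps R) n = (n == 0%N)%:R.
Proof. by change (fps_C 1 n = (n == 0%N)%:R :> R); rewrite /fps_C; case: eqP. Qed.

Lemma fpsDE f g n : (f + g) n = f n + g n. Proof. by []. Qed.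
Lemma fpsNE f n : (- f) n = - f n. Proof. by []. Qed.
Lemma fpsBE f g n : (f - g) n = f n - g n. Proof. by []. Qed.
Lemma fpsME f g n : (f * g) n = \sum_(i < n.+1) f i * g (n - i)%N.
Proof. by []. Qed.

Lemma fps_sumE I (r : seq I) (P : pred I) (F : I -> fps R) n :
  (\sum_(i <- r | P i) F i) n = \sum_(i <- r | P i) F i n.
Proof. by apply: (big_morph (fun f : fps R => f n)) => //; apply: fps0E. Qed.

Lemma fpsME0 f g : (f * g) 0%N = f 0%N * g 0%N.
Proof. by rewrite fpsME big_ord_recl big_ord0 addr0. Qed.

Lemma fpsXE0 f k : (f ^+ k) 0%N = f 0%N ^+ k.
Proof. by elim: k => [|k IHk]; rewrite ?fps1E // !exprS fpsME0 IHk. Qed.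

Fact fps_C_is_zmod_morphism : zmod_morphism (@fps_C R).
Proof.
by move=> a b; apply: funext => n; rewrite fpsBE /fps_C; case: eqP; rewrite ?subr0.
Qed.

Fact fps_C_is_monoid_morphism : monoid_morphism (@fps_C R).
Proof.
split=> // a b; apply: funext => n.
rewrite fpsME big_ord_recl /= subn0 big1 ?addr0 => [|i _]; last by rewrite mul0r.
by rewrite /fps_C /=; case: eqP; rewrite ?mulr0.
Qed.

HB.instance Definition _ :=
  GRing.isZmodMorphism.Build R (fps R) (@fps_C R) fps_C_is_zmod_morphism.
HB.instance Definition _ :=
  GRing.isMonoidMorphism.Build R (fps R) (@fps_C R) fps_C_is_monoid_morphism.

Lemma fps_scaleE c f : fps_scale c f = fps_C c * f.
Proof.
apply: funext => n; rewrite fpsME big_ord_recl /= subn0 big1 ?addr0 // => i _.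
by rewrite mul0r.
Qed.

Lemma fps_powE f k : fps_pow f k = f ^+ k.
Proof. by elim: k => // k IHk; rewrite exprS -IHk. Qed.

Lemma fps_seq_sumE (s : seq (fps R)) : Defs.fps_sum s = \sum_(f <- s) f.
Proof. by elim: s => [|f s IHs]; rewrite ?big_nil // big_cons -IHs. Qed.

Lemma fps_seq_prodE (s : seq (fps R)) : Defs.fps_prod s = \prod_(f <- s) f.
Proof. by elim: s => [|f s IHs]; rewrite ?big_nil // big_cons -IHs. Qed.

Lemma fps_CME c f n : (fps_C c * f) n = c * f n.
Proof. by rewrite -fps_scaleE. Qed.

Lemma fps_natME m f n : (m%:R * f) n = m%:R * f n.
Proof. by rewrite -(rmorph_nat (@fps_C R)) fps_CME. Qed.

Lemma fps_XME f n : (@fps_X R * f) n = if n is m.+1 then f m else 0.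
Proof.
rewrite fpsME big_ord_recl mul0r add0r; case: n => [|n]; first by rewrite big_ord0.
rewrite big_ord_recl mul1r subSS subn0 big1 ?addr0 // => i _.
by rewrite /fps_X mul0r.
Qed.

Lemma fps_XnME f k n :
  (@fps_X R ^+ k * f) n = if (k <= n)%N then f (n - k)%N else 0.
Proof.
elim: k n => [|k IHk] [|n]; rewrite ?mul1r //.
  by rewrite exprS -mulrA fps_XME.
by rewrite exprS -mulrA fps_XME IHk.
Qed.

Lemma fps_XnE k n : (@fps_X R ^+ k) n = (n == k)%:R.
Proof.
rewrite -[_ ^+ k]mulr1 fps_XnME fps1E; have [lekn|ltnk] := leqP k n.
  by rewrite subn_eq0 eqn_leq lekn andbT.
by rewrite ltn_eqF.
Qed.

(** Since [f 0 = 1], coefficient [n] of [f * g] is [g n] plus multiples of lower coefficients of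
    [g]. *)
Lemma fps_lregl f g : f 0%N = 1 -> f * g = 0 -> g = 0.
Proof.
move=> f0 fg0; apply: fpsP => n; rewrite fps0E.
elim/ltn_ind: n => n IHn; have := congr1 (fun h : fps R => h n) fg0.
rewrite fps0E fpsME big_ord_recl f0 mul1r subn0 big1 ?addr0 // => i _.
by rewrite IHn ?mulr0 //= /bump; case: n i {IHn} => [[]|n i]; lia.
Qed.

Lemma fps_exp_poly f (P : {poly R}) n k m :
    (forall i, (i <= n)%N -> P`_i = f i) -> (m <= n)%N ->
  (f ^+ k) m = (P ^+ k)`_m.
Proof.
move=> fP; elim: k m => [|k IHk] m lemn; first by rewrite !expr0 fps1E coef1.
rewrite !exprS; apply: fps_mul_poly => i leim; first exact/fP/(leq_trans leim).
by rewrite IHk // (leq_trans leim).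
Qed.

End FpsRing.

(** * Euler operator, reflection, exponents divisible by [p], and the substitution of [X^p] *)

Section Operators.
Variable R : comUnitRingType.
Implicit Types f g : fps R.

(** The derivation [X d/dX]. It keeps degrees, and over [F_p] its kernel consists of the series in
    [X^p]. *)
Definition fps_euler f : fps R := fun n => n%:R * f n.
Definition fps_reflect f : fps R := fun n => (-1) ^+ n * f n.
Definition fps_part (p : nat) f : fps R := fun n => if (p %| n)%N then f n else 0.
(** The substitution [f(X^p)]. *)
Definition fps_inflate (p : nat) f : fps R :=
  fun n => if (p %| n)%N then f (n %/ p)%N else 0.

Fact fps_euler_is_zmod_morphism : zmod_morphism fps_euler.
Proof. by move=> f g; apply: funext => n; rewrite fpsBE -mulrBr. Qed.

HB.instance Definition _ := GRing.isZmodMorphism.Build (fps R) (fps R)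
  fps_euler fps_euler_is_zmod_morphism.

Fact fps_part_is_zmod_morphism p : zmod_morphism (fps_part p).
Proof.
by move=> f g; apply: funext => n; rewrite fpsBE /fps_part; case: ifP; rewrite ?subr0.
Qed.

HB.instance Definition _ p := GRing.isZmodMorphism.Build (fps R) (fps R)
  (fps_part p) (fps_part_is_zmod_morphism p).

Fact fps_reflect_is_zmod_morphism : zmod_morphism fps_reflect.
Proof. by move=> f g; apply: funext => n; rewrite fpsBE -mulrBr. Qed.

Fact fps_reflect_is_monoid_morphism : monoid_morphism fps_reflect.
Proof.
split=> [|f g]; apply: fpsP => n.
  by rewrite /fps_reflect fps1E; case: n => [|n]; rewrite ?mulr1 ?mulr0.
rewrite fpsME /fps_reflect fpsME mulr_sumr; apply: eq_bigr => i _.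
by rewrite mulrACA -exprD subnKC // -ltnS.
Qed.

HB.instance Definition _ := GRing.isZmodMorphism.Build (fps R) (fps R)
  fps_reflect fps_reflect_is_zmod_morphism.
HB.instance Definition _ := GRing.isMonoidMorphism.Build (fps R) (fps R)
  fps_reflect fps_reflect_is_monoid_morphism.

Lemma fps_eulerM f g : fps_euler (f * g) = fps_euler f * g + f * fps_euler g.
Proof.
apply: fpsP => n; rewrite fpsDE /fps_euler !fpsME mulr_sumr -big_split /=.
apply: eq_bigr => i _; rewrite -{1}(@subnKC i n) -1?ltnS // natrD mulrDl.
by rewrite mulrA mulrCA.
Qed.

Lemma fps_euler1 : fps_euler 1 = 0.
Proof.
by apply: fpsP => n; rewrite /fps_euler fps1E fps0E; case: n => [|n]; rewrite ?mul0r ?mulr0.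
Qed.

Lemma fps_eulerXn f k : fps_euler (f ^+ k.+1) = k.+1%:R * f ^+ k * fps_euler f.
Proof.
elim: k => [|k IHk]; first by rewrite mulr1 mul1r.
by rewrite exprS fps_eulerM IHk exprS; ring.
Qed.

Lemma fps_euler_X : fps_euler (fps_X R) = fps_X R.
Proof.
by apply: fpsP => n; rewrite /fps_euler /fps_X; case: eqP => [->|_]; rewrite ?mulr0 ?mulr1.
Qed.

Lemma fps_eulerXk k : fps_euler (fps_X R ^+ k) = k%:R * fps_X R ^+ k.
Proof.
case: k => [|k]; first by rewrite expr0 mul0r fps_euler1.
by rewrite fps_eulerXn fps_euler_X -mulrA -exprSr.
Qed.

Lemma fps_euler_nat m : fps_euler m%:R = 0.
Proof. by rewrite raddfMn /= fps_euler1 mul0rn. Qed.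

Lemma fps_euler_reflect f : fps_euler (fps_reflect f) = fps_reflect (fps_euler f).
Proof. by apply: fpsP => n; rewrite /fps_euler /fps_reflect mulrCA. Qed.

Lemma fps_reflect_X : fps_reflect (fps_X R) = - fps_X R.
Proof.
apply: fpsP => n; rewrite fpsNE /fps_reflect /fps_X.
by case: eqP => [->|_]; rewrite ?expr1 ?mulr1 ?mulr0 ?oppr0.
Qed.

Lemma fps_euler_inflate p f :
  fps_euler (fps_inflate p f) = p%:R * fps_inflate p (fps_euler f).
Proof.
apply: fpsP => n; rewrite fps_natME /fps_euler /fps_inflate.
by case: ifP => [pn|_]; rewrite ?mulr0 // mulrA -natrM mulnC divnK.
Qed.

Lemma fps_inflateM p f g : (0 < p)%N ->
  fps_inflate p (f * g) = fps_inflate p f * fps_inflate p g.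
Proof.
move=> p_gt0; apply: fpsP => n; rewrite fpsME {1}/fps_inflate.
case: ifPn => [/dvdnP[m ->]|pn]; last first.
  rewrite big1 // => i _; rewrite /fps_inflate; case: ifP => pi; rewrite ?mul0r //.
  by rewrite dvdn_subl // ?(negPf pn) ?mulr0 // -ltnS.
rewrite mulnK // fpsME.
rewrite [RHS](bigID (fun i : 'I__ => p %| i)%N) /= [X in _ + X]big1 ?addr0; last first.
  by move=> i /negPf pi; rewrite /fps_inflate pi mul0r.
have lt_mulp (i : 'I_m.+1) : (i * p < (m * p).+1)%N.
  by rewrite ltnS leq_mul2r -ltnS ltn_ord orbT.
have lt_divp (j : 'I_(m * p).+1) : (j %/ p < m.+1)%N.
  by rewrite ltn_divLR // mulSn; have := ltn_ord j; lia.
(* The surviving indices are the multiples of [p] up to [m * p], matched with [i <= m] by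
   [i * p]. *)
rewrite (reindex_onto (fun i => Ordinal (lt_mulp i)) (fun j => Ordinal (lt_divp j))) /=.
  apply: eq_big => [i|i _]; first by rewrite dvdn_mull //=; apply/esym/eqP/val_inj; rewrite /= mulnK.
  by rewrite /fps_inflate -mulnBl !dvdn_mull // !mulnK.
by move=> j pj; apply: val_inj; rewrite /= divnK.
Qed.

(** Multiplying by a series in [X^p] shifts exponents by multiples of [p] only, so it commutes with
    selecting the exponents divisible by [p]. *)
Lemma fps_partXM p f g : (forall n, ~~ (p %| n)%N -> g n = 0) ->
  fps_part p (f * g) = fps_part p f * g.
Proof.
move=> g0; apply: fpsP => n; rewrite /fps_part !fpsME.
case: ifPn => pn; [apply: eq_bigr => i _ | rewrite big1 // => i _];
    case: ifPn => pi //; rewrite ?mul0r //.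
  by rewrite g0 ?mulr0 // dvdn_subr // -ltnS.
by rewrite g0 ?mulr0 // dvdn_subl // -ltnS.
Qed.

Lemma fps_part_Xn p k :
  fps_part p (fps_X R ^+ k) = if (p %| k)%N then fps_X R ^+ k else 0.
Proof.
apply: fpsP => n; rewrite /fps_part; have [->|nk] := eqVneq n k.
  by case: ifP; rewrite ?fps0E.
by case: ifP; case: ifP; rewrite ?fps0E // fps_XnE (negPf nk).
Qed.

End Operators.

(** * Differential equations and the exponential in characteristic zero *)

Section CharacteristicZero.
Variable F : numFieldType.
Implicit Types f l s u v : fps F.

(** In degree [n + 1] the equation expresses [(n + 1) u_(n+1)] through lower coefficients of [u],
    because [s] has no constant term; then [n + 1] is cancelled. *)
Lemma fps_ode_eq0 s u :
  s 0%N = 0 -> u 0%N = 0 -> fps_euler u = s * u -> u = 0.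
Proof.
move=> s0 u0 ode; apply: fpsP => n; rewrite fps0E; elim/ltn_ind: n => -[//|n] IHn.
have := congr1 (fun h : fps F => h n.+1) ode; rewrite fpsME big_ord_recl s0 mul0r add0r.
rewrite big1 => [/eqP|i _]; last by rewrite IHn ?mulr0 //= /bump subSS ltnS leq_subr.
by rewrite /fps_euler mulf_eq0 pnatr_eq0 => /eqP.
Qed.

Lemma fps_ode_uniq s u v : s 0%N = 0 -> u 0%N = v 0%N ->
  fps_euler u = s * u -> fps_euler v = s * v -> u = v.
Proof.
move=> s0 uv0 odeu odev; apply/eqP; rewrite -subr_eq0; apply/eqP.
apply: (fps_ode_eq0 s0); first by rewrite fpsBE uv0 subrr.
by rewrite raddfB /= odeu odev mulrBr.
Qed.

Definition fps_exp l : fps F := fun n => \sum_(k < n.+1) (l ^+ k) n / (k`!)%:R.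

Lemma fps_exp0 l : fps_exp l 0%N = 1.
Proof. by rewrite /fps_exp big_ord_recl big_ord0 expr0 fps1E divr1 addr0. Qed.

Lemma fps_expr_low l k m : l 0%N = 0 -> (m < k)%N -> (l ^+ k) m = 0.
Proof.
move=> l0; elim: k m => // k IHk m ltmk.
rewrite exprS fpsME big_ord_recl l0 mul0r add0r big1 // => i _.
by rewrite IHk ?mulr0 //= /bump; have := ltn_ord i; lia.
Qed.

(** [l ^+ k] starts in degree [k], so extra terms vanish. A cutoff common to all degrees up to [n]
    allows sums to be exchanged in [fps_euler_exp]. *)
Lemma fps_exp_widen l m n : l 0%N = 0 -> (m <= n)%N ->
  fps_exp l m = \sum_(k < n.+1) (l ^+ k) m / (k`!)%:R.
Proof.
move=> l0 lemn; rewrite /fps_exp.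
rewrite (big_ord_widen n.+1 (fun k => (l ^+ k) m / (k`!)%:R)) // big_mkcond.
by apply: eq_bigr => k _; case: ltnP => // ltmk; rewrite fps_expr_low ?mul0r.
Qed.

Lemma fps_euler_exp l : l 0%N = 0 -> fps_euler (fps_exp l) = fps_euler l * fps_exp l.
Proof.
move=> l0; apply: fpsP => n.
transitivity (\sum_(k < n.+1) (fps_euler l * l ^+ k) n / (k`!)%:R); last first.
  rewrite fpsME; under [RHS]eq_bigr => i _.
    by rewrite (@fps_exp_widen l _ n) ?leq_subr // mulr_sumr; over.
  rewrite exchange_big /=; apply: eq_bigr => k _.
  by rewrite fpsME mulr_suml; apply: eq_bigr => i _; rewrite mulrA.
(* The term [k = n] drops out: [fps_euler l * l ^+ n] starts in degree [n + 1]. *)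
rewrite big_ord_recr /= [X in _ + X / _](_ : _ = 0) ?mul0r ?addr0; last first.
  rewrite mulrC fpsME big_ord_recr /= subnn /fps_euler mul0r mulr0 addr0.
  by rewrite big1 // => i _; rewrite fps_expr_low ?mul0r.
rewrite {1}/fps_euler /fps_exp mulr_sumr big_ord_recl expr0 fps1E /=.
case: n => [|n]; first by rewrite !big_ord0 mul0r addr0.
rewrite mul0r mulr0 add0r; apply: eq_bigr => k _.
(* Regrouped so that [n + 1] turns the coefficient of [l ^+ k.+1] into that of its Euler derivative;
   the resulting factor [k + 1] reduces [(k + 1)!] to [k!]. *)
rewrite -[X in X = _]/(n.+1%:R * ((l ^+ k.+1) n.+1 / (k.+1)`!%:R)) mulrA.
rewrite -[n.+1%:R * _]/(fps_euler (l ^+ k.+1) n.+1) fps_eulerXn.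
rewrite -mulrA fps_natME [l ^+ k * _]mulrC factS natrM invfM mulrACA -mulrA mulVKf //.
by rewrite pnatr_eq0.
Qed.

End CharacteristicZero.

(** * The [p]-adic valuation of factorials *)

(** Bounds Legendre's sum by [n / 2]. The extra term [n %/ p ^ K] carries the induction: with [q]
    its value, the next quotient satisfies [3 (q %/ p) <= q]. *)
Lemma divn_expn_sum_le p n K : (3 <= p)%N ->
  (2 * (\sum_(1 <= k < K.+1) n %/ p ^ k) + n %/ p ^ K <= n)%N.
Proof.
move=> p_ge3; elim: K => [|K IHK]; first by rewrite big_geq // divn1.
rewrite big_nat_recr //= expnSr divnMA.
set q := (n %/ p ^ K)%N in IHK *.
have : (3 * (q %/ p) <= q)%N.
  by apply: leq_trans (leq_trunc_div q p); rewrite mulnC leq_mul2l p_ge3 orbT.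
by move: (q %/ p)%N (\sum_(_ <= _ < _) _)%N IHK => *; lia.
Qed.

Lemma logn_fact_lt p n : prime p -> odd p -> (0 < n)%N -> (logn p n`! < n)%N.
Proof.
move=> hp hodd n_gt0; have p_ge3 : (3 <= p)%N by apply: odd_prime_gt2.
by rewrite logn_fact //; have := divn_expn_sum_le n n p_ge3; move: (\sum_(_ <= _ < _) _)%N (n %/ _)%N; lia.
Qed.

(** * Reduction of [p]-integral rationals *)

Section Reduction.
Variables (p : nat) (hp : prime p).

(** The first conjunct is [p]-integrality; without it [rat_modp] would return the junk value of a
    division by zero. *)
Definition reduces (x : rat) (c : 'F_p) :=
  ((denq x)%:~R != 0 :> 'F_p) /\ rat_modp p x = c.

Lemma reduces_inj x c d : reduces x c -> reduces x d -> c = d.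
Proof. by move=> [_ <-] [_ <-]. Qed.

(** The fraction may be unreduced: the common factor divides [b], hence is invertible mod [p] and
    cancels. *)
Lemma reduces_frac (a b : int) :
  b%:~R != 0 :> 'F_p -> reduces (a%:~R / b%:~R) (a%:~R / b%:~R).
Proof.
have [->|b_neq0] := eqVneq b 0; first by rewrite eqxx.
rewrite /reduces /rat_modp; case: divqP (b_neq0) => // k x k_neq0 _.
rewrite !rmorphM /= mulf_eq0 negb_or => /andP[kp dp]; split=> //.
by rewrite invfM mulrACA divff // mul1r.
Qed.

Lemma reducesD x y c d : reduces x c -> reduces y d -> reduces (x + y) (c + d).
Proof.
move=> [px <-] [py <-]; rewrite -{1}(divq_num_den x) -{1}(divq_num_den y) /rat_modp.
rewrite addf_div ?intr_eq0 ?denq_eq0 // addf_div // -!rmorphM -!rmorphD /=.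
by apply: reduces_frac; rewrite rmorphM mulf_neq0.
Qed.

Lemma reducesM x y c d : reduces x c -> reduces y d -> reduces (x * y) (c * d).
Proof.
move=> [px <-] [py <-]; rewrite -{1}(divq_num_den x) -{1}(divq_num_den y) /rat_modp.
rewrite mulrACA -invfM -!rmorphM /= mulrACA -invfM -!rmorphM /=.
by apply: reduces_frac; rewrite rmorphM mulf_neq0.
Qed.

Lemma reduces_int a : reduces a%:~R a%:~R.
Proof.
by have := @reduces_frac a 1; rewrite !divr1; apply; rewrite oner_neq0.
Qed.

Lemma reduces_nat n : reduces n%:R n%:R.
Proof. exact: (reduces_int n). Qed.

Lemma reducesN x c : reduces x c -> reduces (- x) (- c).
Proof. by move=> xc; rewrite -mulN1r -(mulN1r c); apply: reducesM xc; apply: (reduces_int (-1)). Qed.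

Lemma reduces_sum n (x : 'I_n -> rat) (c : 'I_n -> 'F_p) :
  (forall i, reduces (x i) (c i)) -> reduces (\sum_i x i) (\sum_i c i).
Proof.
move=> xc; apply: (big_ind2 reduces) => //; first exact: (reduces_nat 0).
by move=> *; apply: reducesD.
Qed.

Lemma natFp_eq0 n : (n%:R == 0 :> 'F_p) = (p %| n)%N.
Proof. by rewrite (dvdn_pcharf (pchar_Fp hp)). Qed.

Lemma reduces_div_p x : reduces x 0 -> exists c, reduces (x / p%:R) c.
Proof.
move=> [dx /eqP]; rewrite mulf_eq0 invr_eq0 (negPf dx) orbF => nx.
have [m Em] : exists m : int, numq x = m * p%:Z.
  suff /dvdzP[m ->] : (p%:Z %| numq x)%Z by exists m.
  case: (numq x) nx => n; rewrite ?NegzE ?rmorphN ?dvdzN ?oppr_eq0 -?pmulrn natFp_eq0 //.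
rewrite -(divq_num_den x) Em rmorphM /= mulrAC mulfK.
  by eexists; apply: reduces_frac.
by rewrite intr_eq0 -lt0n prime_gt0.
Qed.

(** These are the coefficients of [exp(pX)], which thus reduces to [1]. Writing [n! = u p^v] with
    [u] prime to [p], what remains is [p^(n-v) / u], and [v < n] for [n > 0]. *)
Lemma reduces_expn_fact n : odd p ->
  reduces (p%:R ^+ n / (n`!)%:R) (n == 0%N)%:R.
Proof.
case: n => [|n] hodd; first by rewrite expr0 divr1; apply: (reduces_nat 1).
have := logn_fact_lt hp hodd (ltn0Sn n).
have [u pu Eu] := pfactor_coprime hp (fact_gt0 n.+1).
move: (logn _ _) Eu => v -> ltvn.
rewrite natrM natrX -{1}(subnK (ltnW ltvn)) exprD -mulf_div divff ?mulr1; last first.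
  by rewrite expf_neq0 // pnatr_eq0 -lt0n prime_gt0.
rewrite -natrX; have := @reduces_frac (p ^ (n.+1 - v))%N u.
rewrite -!pmulrn !natrX (pcharf0 (pchar_Fp hp)) expr0n subn_eq0 leqNgt ltvn mul0r.
by apply; rewrite natFp_eq0 -prime_coprime.
Qed.

(** * Coefficientwise reduction of series, and Frobenius *)

Definition fps_reduces (f : fps rat) (g : fps 'F_p) := forall n, reduces (f n) (g n).

Lemma fps_reduces_inj f g h : fps_reduces f g -> fps_reduces f h -> g = h.
Proof. by move=> fg fh; apply: fpsP => n; apply: reduces_inj (fg n) (fh n). Qed.

Lemma fps_reducesB f g f' g' :
  fps_reduces f g -> fps_reduces f' g' -> fps_reduces (f - f') (g - g').
Proof. by move=> fg fg' n; rewrite !fpsBE; apply/reducesD/reducesN. Qed.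

Lemma fps_reducesM f g f' g' :
  fps_reduces f g -> fps_reduces f' g' -> fps_reduces (f * f') (g * g').
Proof.
by move=> fg fg' n; rewrite !fpsME; apply: reduces_sum => i; apply: reducesM.
Qed.

Lemma fps_reduces1 : fps_reduces 1 1.
Proof. by move=> n; rewrite !fps1E; apply: reduces_nat. Qed.

Lemma fps_reducesX f g k : fps_reduces f g -> fps_reduces (f ^+ k) (g ^+ k).
Proof.
move=> fg; elim: k => [|k IHk]; first exact: fps_reduces1.
by rewrite !exprS; apply: fps_reducesM.
Qed.

Lemma fps_reduces_euler f g : fps_reduces f g -> fps_reduces (fps_euler f) (fps_euler g).
Proof. by move=> fg n; apply/reducesM/fg/reduces_nat. Qed.

Lemma fps_reduces_reflect f g :
  fps_reduces f g -> fps_reduces (fps_reflect f) (fps_reflect g).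
Proof.
move=> fg n; apply/reducesM/fg.
by have := reduces_int ((-1) ^+ n); rewrite !rmorphXn !rmorphN1.
Qed.

Lemma fps_reduces_inflate f g :
  fps_reduces f g -> fps_reduces (fps_inflate p f) (fps_inflate p g).
Proof.
by move=> fg n; rewrite /fps_inflate; case: ifP => _ //; apply: (reduces_nat 0).
Qed.

Lemma Fp_expp (a : 'F_p) : a ^+ p = a.
Proof. by have := expf_card a; rewrite card_Fp. Qed.

Lemma pchar_fps_Fp : p \in [pchar (fps 'F_p)].
Proof.
by rewrite inE hp -(rmorph_nat (@fps_C 'F_p)) (pcharf0 (pchar_Fp hp)) rmorph0 /=.
Qed.

(** To read degree [n], split off the tail from degree [n + 1] on: its [p]-th power starts beyond
    [n]. On the finite part [p]-th powers are additive and fix the coefficients. *)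
Lemma fps_Frobenius (f : fps 'F_p) : f ^+ p = fps_inflate p f.
Proof.
apply: fpsP => n; pose h : fps 'F_p := fun m => f (m + n.+1)%N.
have Ef : f = \sum_(i < n.+1) fps_C (f i) * fps_X 'F_p ^+ i + fps_X 'F_p ^+ n.+1 * h.
  apply: fpsP => m; rewrite fpsDE fps_sumE fps_XnME.
  under eq_bigr do rewrite fps_CME fps_XnE.
  case: ltnP => [ltnm|lemn].
    rewrite big1 ?add0r /h ?subnK // => i _.
    by rewrite gtn_eqF ?mulr0 // (leq_trans (ltn_ord i)).
  rewrite (bigD1 (Ordinal (lemn : (m < n.+1)%N))) //= eqxx mulr1 big1 ?addr0 // => i.
  by rewrite -val_eqE eq_sym /= => /negPf ->; rewrite mulr0.
have exprDp (u v : fps 'F_p) : (u + v) ^+ p = u ^+ p + v ^+ p.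
  by apply: exprDn_pchar; rewrite (eq_pnat _ (pcharf_eq pchar_fps_Fp)) pnat_id.
have expr0p : (0 : fps 'F_p) ^+ p = 0 by rewrite expr0n gtn_eqF ?prime_gt0.
rewrite {1}Ef exprDp (big_morph _ exprDp expr0p) exprMn -exprM fpsDE fps_sumE.
rewrite fps_XnME ifN ?addr0; last by rewrite -ltnNge leq_pmulr ?prime_gt0.
under eq_bigr => i _.
  rewrite exprMn -rmorphXn -exprM fps_CME fps_XnE.
  rewrite Fp_expp; over.
rewrite /fps_inflate; case: ifP => [/dvdnP[m ->]|pn].
  have ltm : (m < (m * p).+1)%N by rewrite ltnS leq_pmulr ?prime_gt0.
  rewrite mulnK ?prime_gt0 // (bigD1 (Ordinal ltm)) //= eqxx mulr1 big1 ?addr0 // => i.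
  by rewrite -val_eqE eqn_pmul2r ?prime_gt0 // eq_sym => /negPf ->; rewrite mulr0.
rewrite big1 // => i _; case: eqP => [Ei|_]; last by rewrite mulr0.
by rewrite Ei dvdn_mull in pn.
Qed.

(** * The Artin-Hasse series over [Q] and its [p]-integrality *)

(** The series [sum_i X^(p^i)] with [i = 0] included, called [S] in the overview once read in
    [F_p]. *)
Definition ppow_series (R : comUnitRingType) : fps R :=
  fun n => [exists i : 'I_n.+1, (p ^ i == n)%N]%:R.

Lemma ppow_existsP n :
  reflect (exists i, p ^ i = n)%N [exists i : 'I_n.+1, (p ^ i == n)%N].
Proof.
apply: (iffP existsP) => [[i /eqP]|[i pin]]; first by exists i.
have ltin : (i < n.+1)%N by rewrite ltnS -pin ltnW // ltn_expl ?prime_gt1.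
by exists (Ordinal ltin); apply/eqP.
Qed.

Lemma ppow_series0 (R : comUnitRingType) : ppow_series R 0%N = 0.
Proof.
rewrite /ppow_series; case: ppow_existsP => // -[i Ei].
by have := expn_gt0 p i; rewrite Ei (prime_gt0 hp).
Qed.

Lemma ppow_series_expand (R : comUnitRingType) :
  ppow_series R = fps_X R + fps_inflate p (ppow_series R).
Proof.
apply: fpsP => n; rewrite fpsDE /fps_X /fps_inflate /ppow_series.
have [->|n_neq1] := eqVneq n 1%N.
  rewrite dvdn1 gtn_eqF ?prime_gt1 // addr0.
  by case: ppow_existsP => // -[]; exists 0%N.
rewrite add0r; case: ifPn => pn.
  congr (nat_of_bool _)%:R; apply/ppow_existsP/ppow_existsP => -[i Ei].
    case: i Ei => [|i] Ei; first by rewrite -Ei eqxx in n_neq1.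
    by exists i; rewrite -Ei expnS mulKn ?prime_gt0.
  by exists i.+1; rewrite expnS Ei mulnC divnK.
case: ppow_existsP => // -[[|i] Ei]; first by rewrite -Ei eqxx in n_neq1.
by rewrite -Ei dvdn_exp in pn.
Qed.

Lemma ppow_series_reflect (R : comUnitRingType) : odd p ->
  fps_reflect (ppow_series R) = - ppow_series R.
Proof.
move=> hodd; apply: fpsP => n; rewrite fpsNE /fps_reflect /ppow_series.
case: ppow_existsP => [[i <-]|_]; last by rewrite mulr0 oppr0.
by rewrite -signr_odd oddX hodd orbT mulr1.
Qed.

Lemma fps_reduces_ppow : fps_reduces (ppow_series rat) (ppow_series 'F_p).
Proof. by move=> n; apply: reduces_nat. Qed.

Definition ah_log : fps rat := fun n => ppow_series rat n / n%:R.

Lemma ah_log0 : ah_log 0%N = 0.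
Proof. by rewrite /ah_log ppow_series0 mul0r. Qed.

Lemma fps_euler_ah_log : fps_euler ah_log = ppow_series rat.
Proof.
apply: fpsP => -[|n]; first by rewrite /fps_euler mul0r ppow_series0.
by rewrite /fps_euler /ah_log mulrC divfK // pnatr_eq0.
Qed.

Lemma coef_ah_log_trunc n m : (m <= n)%N -> (ah_log_trunc p n)`_m = ah_log m.
Proof.
move=> lemn; rewrite /ah_log_trunc coef_sum /ah_log /ppow_series.
case: ppow_existsP => [[j Ej]|noj]; last first.
  rewrite mul0r big1 // => i _; rewrite coefZ coefXn.
  by case: eqP => [Ei|]; rewrite ?mulr0 //; case: noj; exists i.
have ltjn : (j < n.+1)%N.
  by rewrite ltnS (leq_trans _ lemn) // -Ej ltnW // ltn_expl ?prime_gt1.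
rewrite (bigD1 (Ordinal ltjn)) /= ?Ej // coefZ coefXn eqxx mulr1 big1 ?addr0 ?mul1r //.
move=> i /andP[_]; rewrite coefZ coefXn -Ej eqn_exp2l ?prime_gt1 // -val_eqE eq_sym.
by move=> /negPf ->; rewrite mulr0.
Qed.

(** Truncating the logarithm above degree [n] does not affect coefficient [n] of its powers. This
    gives access to the differential equation of the exponential. *)
Lemma ah_coefE : ah_coef p = fps_exp ah_log.
Proof.
apply: fpsP => n; apply: eq_bigr => k _; congr (_ / _).
by rewrite (@fps_exp_poly _ ah_log (ah_log_trunc p n) n) // => m; apply: coef_ah_log_trunc.
Qed.

Lemma ah_coef0 : ah_coef p 0%N = 1.
Proof. by rewrite ah_coefE fps_exp0. Qed.

Lemma fps_euler_ah :
  fps_euler (ah_coef p : fps rat) = ppow_series rat * (ah_coef p : fps rat).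
Proof. by rewrite ah_coefE fps_euler_exp ?ah_log0 // fps_euler_ah_log. Qed.

Definition exp_pX : fps rat := fun n => p%:R ^+ n / (n`!)%:R.

Lemma fps_euler_exp_pX : fps_euler exp_pX = p%:R * fps_X rat * exp_pX.
Proof.
apply: fpsP => n; rewrite -mulrA fps_natME fps_XME /fps_euler /exp_pX.
case: n => [|n]; first by rewrite mul0r mulr0.
rewrite factS natrM exprS -mulf_div [LHS]mulrA; congr (_ * _).
by rewrite mulrC divfK // pnatr_eq0.
Qed.

(* Both sides solve [X Y' = p (sum_i X^(p^i)) Y] with [Y(0) = 1]. *)
Lemma ah_expp :
  (ah_coef p : fps rat) ^+ p = fps_inflate p (ah_coef p) * exp_pX.
Proof.
have p_gt0 := prime_gt0 hp.
apply: (@fps_ode_uniq _ (p%:R * ppow_series rat)).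
- by rewrite fps_natME ppow_series0 mulr0.
- rewrite fpsXE0 fpsME0 /fps_inflate dvdn0 div0n ah_coef0 /exp_pX expr0 expr1n.
  by rewrite !mul1r fact0 invr1.
- by rewrite -[X in _ ^+ X](prednK p_gt0) fps_eulerXn exprSr prednK // fps_euler_ah; ring.
rewrite fps_eulerM fps_euler_inflate fps_euler_ah fps_inflateM // fps_euler_exp_pX.
rewrite [in RHS]ppow_series_expand; ring.
Qed.

(** All exponents [p^i] are odd, so the logarithmic derivatives of the two factors cancel; the
    product has Euler derivative [0] and constant term [1]. *)
Lemma ah_reflect : odd p ->
  (ah_coef p : fps rat) * fps_reflect (ah_coef p) = 1.
Proof.
move=> hodd; apply: (@fps_ode_uniq _ 0); first exact: fps0E.
- by rewrite fpsME0 /fps_reflect ah_coef0 fps1E !mulr1.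
- rewrite fps_eulerM fps_euler_reflect fps_euler_ah rmorphM /= ppow_series_reflect //.
  ring.
- by rewrite mul0r fps_euler1.
Qed.

(* Dwork's argument: with [g] the truncation of [AH] below degree [n], the n-th
   coefficient of [AH^p = AH(X^p) exp(pX)] reads
   [p a_n = (g(X^p) exp(pX) - g^p)_n], and the right-hand series vanishes mod p
   because of Frobenius. *)
Lemma ah_reduces : odd p -> fps_reduces (ah_coef p) (Ep p).
Proof.
move=> hodd n; rewrite /Ep; suff [c [dx _]] : exists c, reduces (ah_coef p n) c by [].
elim/ltn_ind: n => -[_|n IHn].
  by rewrite ah_coef0; exists 1; apply: (reduces_nat 1).
pose f : fps rat := ah_coef p; pose g : fps rat := fun i => if (i < n.+1)%N then f i else 0.
pose gp : fps 'F_p := fun i => rat_modp p (g i).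
have p_gt0 := prime_gt0 hp.
have g_gp : fps_reduces g gp.
  move=> i; rewrite /gp /g; case: ifP => [/IHn[c []] //|_].
  by have [] := reduces_nat 0.
have u0 : fps_reduces (fps_inflate p g * exp_pX - g ^+ p) 0.
  have -> : 0 = fps_inflate p gp * 1 - gp ^+ p by rewrite fps_Frobenius mulr1 subrr.
  apply/fps_reducesB/fps_reducesX/g_gp/fps_reducesM; first exact: fps_reduces_inflate.
  by move=> k; rewrite fps1E; apply: reduces_expn_fact.
have := u0 n.+1; rewrite fps0E => /reduces_div_p[c].
suff -> : (fps_inflate p g * exp_pX - g ^+ p) n.+1 = p%:R * f n.+1.
  by rewrite mulrC mulKf ?pnatr_eq0 -?lt0n // => fc; exists c.
(* [f(X^p)] and [g(X^p)] agree through degree [n + 1], since [(n + 1) %/ p <= n]. *)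
have -> : (fps_inflate p g * exp_pX - g ^+ p) n.+1 = (f ^+ p - g ^+ p) n.+1.
  rewrite !fpsBE; congr (_ - _); rewrite ah_expp !fpsME; apply: eq_bigr => i _.
  congr (_ * _); rewrite /fps_inflate /g; case: ifP => // _.
  rewrite ifT // ltn_divLR // (leq_ltn_trans (leq_ord i)) //.
  by rewrite ltn_Pmulr ?prime_gt1.
pose h : fps rat := fun m => f (m + n.+1)%N.
have Efg : f - g = fps_X rat ^+ n.+1 * h.
  apply: fpsP => m; rewrite fpsBE fps_XnME /h /g.
  by case: ltnP => [_|lenm]; rewrite ?subrr ?subnK ?subr0.
(* In [f^p - g^p = (f - g) sum_i f^(p-1-i) g^i] the first factor starts with [f n.+1] in degree
   [n + 1], and the second has constant term [p]. *)
rewrite subrXX Efg -mulrA fps_XnME leqnn subnn fpsME0 /h add0n mulrC; congr (_ * _).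
rewrite fps_sumE (eq_bigr (fun=> 1)) => [|i _]; first by rewrite sumr_const card_ord.
by rewrite fpsME0 !fpsXE0 /g /f ah_coef0 !expr1n mulr1.
Qed.

End Reduction.

(** * Wilson's theorem, the series [T], and products of [j - c] modulo [p] *)

Lemma deriv_prod_nat (R : comNzRingType) (a : nat -> R) m n : (m <= n)%N ->
  (\prod_(m <= j < n) ((a j)%:P - 'X))^`() =
  - \sum_(m <= k < n) (\prod_(m <= j < k) ((a j)%:P - 'X)) *
                      (\prod_(k.+1 <= j < n) ((a j)%:P - 'X)).
Proof.
elim: n => [|n IHn]; first by rewrite leqn0 => /eqP->; rewrite !big_geq // derivC oppr0.
rewrite leq_eqVlt ltnS => /orP[/eqP->|lemn].
  by rewrite !big_geq // derivC oppr0.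
rewrite (big_nat_recr n) //= derivM IHn // derivB derivC derivX.
rewrite [in RHS](big_nat_recr n) //= [X in _ = - (_ + _ * X)]big_geq // mulr1.
rewrite sub0r mulrN1 opprD mulNr mulr_suml; congr (- _ - _).
apply: eq_big_nat => k /andP[_ ltkn].
by rewrite [in RHS]big_nat_recr //= mulrA.
Qed.

Section ModP.
Variables (p : nat) (hp : prime p) (hodd : odd p).
Notation X := (fps_X 'F_p).
Notation T := (Tser p).

(** Wilson's theorem is the case [k = 0]; each step trades a factor [p - 1 - k] for [-(k + 1)],
    congruent to it. *)
Lemma pred_factorial_Fp k : (k < p)%N ->
  (-1) ^+ k * (k`!)%:R * ((p.-1 - k)`!)%:R = -1 :> 'F_p.
Proof.
have p_gt1 := prime_gt1 hp.
elim: k => [|k IHk] ltkp.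
  rewrite mul1r subn0 mul1r; apply/eqP; rewrite -addr_eq0 natr1.
  by rewrite natFp_eq0 // -Wilson.
rewrite -[RHS](IHk (ltnW ltkp)) (_ : p.-1 - k = (p.-1 - k.+1).+1)%N; last by lia.
rewrite !factS exprS !natrM; set m := (p.-1 - k.+1)%N.
have -> : m.+1%:R = - k.+1%:R :> 'F_p.
  apply/eqP; rewrite -addr_eq0 -natrD natFp_eq0 // (_ : m.+1 + k.+1 = p)%N //.
  by rewrite /m; lia.
by ring.
Qed.

Lemma Tser0 : T 0%N = 0.
Proof. by rewrite /Tser; case: existsP => // -[[[|i]] //= lti]. Qed.

Lemma ppow_seriesE : ppow_series p 'F_p = X + T.
Proof.
apply: fpsP => n; rewrite fpsDE /ppow_series /fps_X /Tser.
have [->|n_neq1] := eqVneq n 1%N.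
  case: (ppow_existsP hp) => [_|[]]; last by exists 0%N.
  case: existsP => [[[[|i] lti] //= ]|]; last by rewrite addr0.
  move=> /eqP Ei; have := dvdn_exp (ltn0Sn i) (dvdnn p).
  by rewrite Ei dvdn1 gtn_eqF ?prime_gt1.
rewrite add0r; congr (nat_of_bool _)%:R; apply: eq_existsb => -[[|i] lti] //=.
by rewrite expn0 eq_sym (negPf n_neq1).
Qed.

Lemma TserE : T = fps_inflate p (ppow_series p 'F_p).
Proof. by apply: (addrI X); rewrite -ppow_series_expand // ppow_seriesE. Qed.

(** By Frobenius, [T = S(X^p) = S^p = X^p + T^p] with [S = X + T]. *)
Lemma Tser_expp : T ^+ p = T - X ^+ p.
Proof.
apply/eqP; rewrite -subr_eq opprK addrC; apply/eqP.
rewrite [RHS]TserE -fps_Frobenius // ppow_seriesE.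
by rewrite -!(pFrobenius_autE (pchar_fps_Fp hp)) rmorphD.
Qed.

Lemma Tser_reflect : fps_reflect T = - T.
Proof.
apply: (addrI (- X)); rewrite -fps_reflect_X -rmorphD /= -ppow_seriesE.
by rewrite ppow_series_reflect // ppow_seriesE opprD fps_reflect_X.
Qed.

Lemma fps_euler_Tser : fps_euler T = 0.
Proof.
by rewrite TserE fps_euler_inflate // (pcharf0 (pchar_fps_Fp hp)) mul0r.
Qed.

Lemma fps_euler_eq0 (f : fps 'F_p) :
  fps_euler f = 0 -> forall n, ~~ (p %| n)%N -> f n = 0.
Proof.
move=> f0 n pn; have /eqP := congr1 (fun h : fps 'F_p => h n) f0.
by rewrite fps0E mulf_eq0 natFp_eq0 // (negPf pn) => /eqP.
Qed.

Lemma fps_euler_prod_eq0 (I : Type) (r : seq I) (F : I -> fps 'F_p) :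
  (forall i, fps_euler (F i) = 0) -> fps_euler (\prod_(i <- r) F i) = 0.
Proof.
move=> F0; apply: (big_ind (fun f : fps 'F_p => fps_euler f = 0)) => //.
  exact: fps_euler1.
by move=> f g f0 g0; rewrite fps_eulerM f0 g0 mul0r mulr0 addr0.
Qed.

(** By Fermat, [1, ..., p - 1] are distinct roots of [X^(p-1) - 1], as many as its degree; turning
    each [j - X] into [X - j] costs the sign [(-1)^(p-1) = 1]. *)
Lemma prod_natFp_subX :
  \prod_(1 <= j < p) (j%:R%:P - 'X) = 'X^(p.-1) - 1 :> {poly 'F_p}.
Proof.
have p_gt1 := prime_gt1 hp.
have p_gt0 := ltnW p_gt1; have p1_gt0 : (0 < p.-1)%N by rewrite -ltnS prednK.
have lcq : lead_coef ('X^(p.-1) - 1 : {poly 'F_p}) = 1.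
  by rewrite -polyC1 lead_coefXnsubC.
have szq : size ('X^(p.-1) - 1 : {poly 'F_p}) = p.
  by rewrite -polyC1 size_XnsubC ?prednK.
have := @all_roots_prod_XsubC _ ('X^(p.-1) - 1 : {poly 'F_p}) [seq j%:R | j <- index_iota 1 p].
rewrite lcq scale1r big_map szq => ->.
- rewrite (eq_bigr (fun j => -1 * ('X - j%:R%:P))) => [|j _]; last by rewrite mulN1r opprB.
  rewrite big_split /= prodr_const_nat -signr_odd oddB ?prime_gt0 // hodd mul1r.
  by [].
- by rewrite size_map size_iota subn1 prednK.
- apply/allP => x /mapP[j]; rewrite mem_index_iota => /andP[j_gt0 ltjp] ->.
  have j_neq0 : j%:R != 0 :> 'F_p by rewrite natFp_eq0 // gtnNdvd.
  rewrite rootE !hornerE subr_eq0; apply/eqP/(mulfI j_neq0).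
  by rewrite mulr1 -exprS prednK // Fp_expp.
- rewrite uniq_rootsE map_inj_in_uniq ?iota_uniq // => i j.
  rewrite !mem_index_iota => /andP[_ ltip] /andP[_ ltjp] /(congr1 val).
  by rewrite /= !val_Fp_nat // !modn_small.
Qed.

Section Evaluate.
Variable c : fps 'F_p.

Let horner_prod (r : seq nat) :
  (map_poly (@fps_C 'F_p) (\prod_(j <- r) (j%:R%:P - 'X))).[c] = \prod_(j <- r) (j%:R - c).
Proof.
rewrite rmorph_prod horner_prod; apply: eq_bigr => j _.
by rewrite rmorphB /= map_polyC map_polyX !hornerE; congr (_ - _); apply: (rmorph_nat (@fps_C _)).
Qed.

Lemma prod_nat_sub_fps : \prod_(1 <= j < p) (j%:R - c) = c ^+ p.-1 - 1.
Proof.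
rewrite -horner_prod prod_natFp_subX rmorphB /= map_polyXn rmorph1.
by rewrite !hornerE.
Qed.

(** Obtained by differentiating [prod_natFp_subX] and evaluating at [c]: the product rule gives
    minus the sum, and [(p - 1) c^(p-2) = - c^(p-2)]. *)
Lemma sum_prod_nat_sub_fps :
  \sum_(1 <= k < p) (\prod_(1 <= j < k) (j%:R - c)) * (\prod_(k.+1 <= j < p) (j%:R - c))
  = c ^+ p.-2.
Proof.
have := congr1 (fun r => (map_poly (@fps_C 'F_p) r^`()).[c]) prod_natFp_subX.
rewrite /= (@deriv_prod_nat _ (fun j => j%:R) 1 p) ?prime_gt0 //.
rewrite rmorphN rmorph_sum /= hornerN horner_sum => /eqP; rewrite eqr_oppLR => /eqP Esum.
transitivity (- (map_poly (@fps_C 'F_p) ('X^(p.-1) - 1)^`()).[c]).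
  rewrite -Esum; apply: eq_bigr => k _.
  by rewrite rmorphM /= hornerM !horner_prod.
rewrite derivB derivXn -polyC1 derivC subr0 rmorphMn /= map_polyXn hornerMn hornerXn.
have -> : c ^+ p.-2 *+ p.-1 = c ^+ p.-2 *+ p - c ^+ p.-2.
  by rewrite -[X in _ = _ *+ X - _](prednK (prime_gt0 hp)) mulrSr addrK.
by rewrite -mulr_natr (pcharf0 (pchar_fps_Fp hp)) mulr0 sub0r opprK.
Qed.

End Evaluate.

(** * The Laguerre polynomial modulo [p] *)

(** By [pred_factorial_Fp] every numerical coefficient [(-1)^k / (k! (p-1-k)!)] is [-1]. *)
Lemma laguerre_pm1E (alpha : fps 'F_p) :
  laguerre_pm1 p alpha =
    - \sum_(0 <= k < p) X ^+ k * \prod_(k.+1 <= j < p) (j%:R + alpha).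
Proof.
rewrite /laguerre_pm1 fps_seq_sumE big_map -sumrN /index_iota subn0.
apply: eq_big_seq => k; rewrite mem_iota add0n => /= ltkp.
rewrite /fps_binom_am1 fps_seq_prodE big_map !fps_scaleE fps_powE.
rewrite fps_mulE mulrACA -rmorphM /=.
have -> : (((p.-1 - k)`!)%:R)^-1 * ((-1) ^+ k / (k`!)%:R) = -1 :> 'F_p.
  have Efact : ((p.-1 - k)`!)%:R * (k`!)%:R = - (-1) ^+ k :> 'F_p.
    have := congr1 ( *%R ((-1) ^+ k)) (pred_factorial_Fp ltkp).
    by rewrite -mulrA !mulrA -expr2 sqrr_sign mul1r mulrN1 mulrC.
  by rewrite mulrCA -invfM Efact invrN mulrN divff // signr_eq0.
rewrite rmorphN1 mulN1r mulrC; congr (- (_ * _)).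
have -> : \prod_(k.+1 <= j < p) (j%:R + alpha) = 
          \prod_(0 <= j < p.-1 - k) ((j + k.+1)%:R + alpha).
  by rewrite -{1}[k.+1]add0n big_addn (_ : p - k.+1 = p.-1 - k)%N //; lia.
(* The factors [alpha - i], [1 <= i <= p-1-k], equal [alpha + (p - i)]; reversing the order makes
   [p - i] run upwards from [k + 1]. *)
rewrite big_nat_rev /= /index_iota subn0 add0n; apply: eq_big_seq => j.
rewrite mem_iota => /= ltj; rewrite fps_addE addrC; congr (_ + _).
rewrite rmorphN rmorph_nat; apply/esym/eqP; rewrite -addr_eq0 -natrD.
rewrite (_ : _ + _ = p)%N; first by rewrite (pcharf0 (pchar_fps_Fp hp)).
by lia.
Qed.

Notation L := (laguerre_pm1 p (- T)).
Notation A k := (\prod_(k <= j < p) (j%:R - T)).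

Lemma fps_euler_prod_sub_Tser m n : fps_euler (\prod_(m <= j < n) (j%:R - T)) = 0.
Proof.
by apply: fps_euler_prod_eq0 => j; rewrite raddfB /= fps_euler_nat fps_euler_Tser subrr.
Qed.

Lemma Tser_mul_prod : T * A 1%N = - X ^+ p.
Proof.
rewrite prod_nat_sub_fps mulrBr mulr1 -exprS prednK ?prime_gt0 // Tser_expp.
by rewrite addrC addKr.
Qed.

(** As [T] is killed by the Euler operator, it multiplies [X^k A_(k+1)] by [k]. Since
    [(k - T) A_(k+1) = A_k], the defect is the sum of [X^(k+1) A_(k+1) - X^k A_k], telescoping to
    [X^p - A_0 = X^p + T A_1 = 0]. *)
Lemma fps_euler_laguerre : fps_euler L = (X + T) * L.
Proof.
have -> : L = - \sum_(0 <= k < p) X ^+ k * A k.+1 by exact: laguerre_pm1E.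
have tele : \sum_(0 <= k < p) (X ^+ k.+1 * A k.+1 - X ^+ k * A k) = 0.
  rewrite telescope_sumr // big_geq // mulr1 mul1r big_ltn ?prime_gt0 // sub0r.
  by rewrite mulNr Tser_mul_prod opprK subrr.
apply/eqP; rewrite raddfN mulrN /= eqr_opp -subr_eq0 -[eqbRHS]oppr0 -[X in _ == - X]tele mulr_sumr.
rewrite [fps_euler _]raddf_sum.
rewrite -sumrB -sumrN; apply/eqP/eq_big_nat => k /andP[_ ltkp] /=.
rewrite fps_eulerM fps_eulerXk fps_euler_prod_sub_Tser mulr0 addr0.
by rewrite [in RHS](big_ltn ltkp) exprS; ring.
Qed.

Lemma fps_part_Xn_mul k (f : fps 'F_p) : fps_euler f = 0 ->
  fps_part p (X ^+ k * f) = if (p %| k)%N then X ^+ k * f else 0.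
Proof.
move=> f0; rewrite fps_partXM; last exact: fps_euler_eq0.
by rewrite fps_part_Xn; case: ifP; rewrite ?mul0r.
Qed.

(** The products [A k.+1] are series in [X^p], so among [0 <= k < p] only [k = 0] contributes. *)
Lemma fps_part_laguerre : fps_part p L = - A 1%N.
Proof.
have -> : L = - \sum_(0 <= k < p) X ^+ k * A k.+1 by exact: laguerre_pm1E.
rewrite raddfN raddf_sum /= big_ltn ?prime_gt0 //.
rewrite fps_part_Xn_mul ?fps_euler_prod_sub_Tser // dvdn0 mul1r [X in _ + X]big_nat [X in _ + X]big1 ?addr0 //.
move=> k /andP[k_gt0 ltkp].
by rewrite fps_part_Xn_mul ?fps_euler_prod_sub_Tser // gtnNdvd.
Qed.

Lemma fps_reflect_laguerre : fps_reflect L =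
  - \sum_(0 <= l < p) X ^+ l * \prod_(1 <= j < p - l) (j%:R - T).
Proof.
have -> : L = - \sum_(0 <= k < p) X ^+ k * A k.+1 by exact: laguerre_pm1E.
rewrite rmorphN rmorph_sum; congr (- _); apply: eq_big_nat => l /andP[_ ltlp].
rewrite rmorphM rmorphXn /= fps_reflect_X rmorph_prod /=.
rewrite -[l.+1]add1n big_addn big_nat_rev /=.
rewrite (eq_big_nat _ _ (F2 := fun j => -1 * (j%:R - T))); last first.
  move=> j /andP[j_gt0 ltj]; rewrite rmorphB rmorph_nat /= Tser_reflect opprK.
  rewrite mulN1r opprB addrC; congr (_ + _); apply/eqP; rewrite -addr_eq0 -natrD.
  rewrite (_ : _ + _ = p)%N; first by rewrite (pcharf0 (pchar_fps_Fp hp)).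
  by lia.
(* The signs [(-1)^l] from [X^l] and [(-1)^(p-1-l)] from the factors [j + T = -((p - j) - T)]
   combine to [(-1)^(p-1) = 1]. *)
rewrite big_split /= prodr_const_nat exprNn mulrCA !mulrA -exprD.
rewrite -signr_odd (_ : odd _ = false) ?mul1r //.
rewrite (_ : _ + _ = p - 1)%N; last by lia.
by rewrite oddB ?hodd ?prime_gt0.
Qed.

(** In the double sum over [k, l < p] only exponents [k + l] equal to [0] or [p] survive: the first
    gives [Pi^2], the second [X^p T^(p-2)] by [sum_prod_nat_sub_fps]. *)
Lemma fps_part_laguerre_reflect : fps_part p (L * fps_reflect L) = - A 1%N.
Proof.
rewrite fps_reflect_laguerre.
have -> : L = - \sum_(0 <= k < p) X ^+ k * A k.+1 by exact: laguerre_pm1E.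
have p_gt0 := prime_gt0 hp.
pose B l := \prod_(1 <= j < p - l) (j%:R - T).
have part_term k l : fps_part p (X ^+ k * A k.+1 * (X ^+ l * B l)) =
    if (p %| k + l)%N then X ^+ (k + l) * (A k.+1 * B l) else 0.
  rewrite mulrACA -exprD fps_part_Xn_mul // fps_eulerM !fps_euler_prod_sub_Tser.
  by rewrite mul0r mulr0 addr0.
rewrite mulrNN mulr_suml [fps_part p _]raddf_sum [LHS](big_ltn p_gt0) /=.
rewrite mulr_sumr [X in X + _]raddf_sum [X in X + _](big_ltn p_gt0) /= part_term dvdn0 mul1r.
rewrite [X in _ + X + _]big_nat [X in _ + X + _]big1 ?addr0; last first.
  by move=> l /andP[l_gt0 ltlp]; rewrite part_term add0n gtnNdvd.
have -> : \sum_(1 <= k < p) fps_part p (X ^+ k * A k.+1 *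
      (\sum_(0 <= l < p) X ^+ l * B l)) = X ^+ p * T ^+ p.-2.
  rewrite -sum_prod_nat_sub_fps mulr_sumr; apply: eq_big_nat => k /andP[k_gt0 ltkp].
  rewrite mulr_sumr raddf_sum /=.
  (* For [k > 0] only [l = p - k] survives: smaller [l] give [0 < k + l < p], larger ones
     [p < k + l < 2p]. *)
  rewrite (@big_cat_nat _ _ _ (p - k)) ?leq_subr //= [X in _ + X]big_ltn ?ltn_subrL ?k_gt0 //.
  rewrite [X in X + _]big_nat big1 ?add0r; last first.
    move=> l /andP[_ ltl]; rewrite part_term gtnNdvd ?addn_gt0 ?k_gt0 //.
    by rewrite -ltn_subRL.
  rewrite [X in _ + X]big_nat [X in _ + X]big1 ?addr0; last first.
    move=> l /andP[gtl ltl]; rewrite part_term ifN //.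
    by apply/negP => /dvdnP[[|[|m]]]; lia.
  by rewrite part_term subnKC ?(ltnW ltkp) // dvdnn /B subKn ?(ltnW ltkp) // [A _ * _]mulrC.
have Xp : X ^+ p = - (T * A 1%N) by rewrite Tser_mul_prod opprK.
have Tp : T ^+ p.-1 = T * T ^+ p.-2.
  by rewrite -exprS prednK // -ltnS prednK // prime_gt1.
(* With [X^p = - T Pi] the total is [Pi (Pi - T^(p-1)) = - Pi]. *)
by rewrite /B subn0 Xp prod_nat_sub_fps Tp; ring.
Qed.

(** * The Artin-Hasse series modulo [p] and the two identities *)

Notation E := (Ep p).

Lemma fps_euler_Ep : fps_euler E = (X + T) * E.
Proof.
have := fps_reduces_euler (ah_reduces hp hodd); rewrite fps_euler_ah // => redE.
rewrite -ppow_seriesE; apply: fps_reduces_inj redE _.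
by apply: fps_reducesM (ah_reduces hp hodd); apply: fps_reduces_ppow.
Qed.

Lemma Ep_reflect : E * fps_reflect E = 1.
Proof.
apply: (fps_reduces_inj (f := 1)); last exact: fps_reduces1.
rewrite -(ah_reflect hp hodd).
by apply: fps_reducesM; last apply: fps_reduces_reflect; apply: ah_reduces.
Qed.

Lemma Ep0 : E 0%N = 1.
Proof. by apply: reduces_inj (ah_reduces hp hodd 0%N) _; rewrite (ah_coef0 hp); apply: (@reduces_nat p 1). Qed.

(** As [p] is odd, [(-1)^m = (-1)^(mp)], so the alternating sign is the substitution of [-X]. *)
Lemma Ep_sub_signE : Ep_sub_sign p = fps_reflect (fps_part p E).
Proof.
apply: fpsP => n; rewrite /Ep_sub_sign /fps_reflect /fps_part.
case: ifP => [/dvdnP[m ->]|_]; last by rewrite mulr0.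
by rewrite mulnK ?prime_gt0 // mulnC exprM -(signr_odd _ p) hodd.
Qed.

Lemma fps_reflectK (f : fps 'F_p) : fps_reflect (fps_reflect f) = f.
Proof. by apply: fpsP => n; rewrite /fps_reflect signrMK. Qed.

Lemma laguerre_Ep :
  L = E * Ep_sub_sign p /\ fps_part p E * Ep_sub_sign p = - A 1%N.
Proof.
have [G LE dG] : exists2 G, L = E * G & fps_euler G = 0.
  exists (L * fps_reflect E); first by rewrite mulrCA Ep_reflect mulr1.
  rewrite fps_eulerM fps_euler_laguerre fps_euler_reflect fps_euler_Ep rmorphM rmorphD /=.
  by rewrite fps_reflect_X Tser_reflect; ring.
have dsG : fps_euler (fps_reflect G) = 0 by rewrite fps_euler_reflect dG rmorph0.
have EG : fps_part p E * G = - A 1%N.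
  by rewrite -fps_partXM -?LE ?fps_part_laguerre //; apply: fps_euler_eq0.
have GG : G * fps_reflect G = - A 1%N.
  rewrite -fps_part_laguerre_reflect LE rmorphM mulrACA Ep_reflect mul1r.
  rewrite -[X in fps_part p X]mul1r fps_partXM; last first.
    by apply: fps_euler_eq0; rewrite fps_eulerM dG dsG mul0r mulr0 addr0.
  by rewrite -(expr0 X) fps_part_Xn dvdn0 expr0 mul1r.
(* Read from constant terms in [EG], as [- A 1 = 1 - T^(p-1)] and [T] has none; this makes [G]
   cancellable. *)
have G0 : G 0%N = 1.
  have := congr1 (fun f : fps 'F_p => f 0%N) EG.
  rewrite fpsME0 /fps_part dvdn0 Ep0 mul1r => ->.
  rewrite prod_nat_sub_fps fpsNE fpsBE fpsXE0 Tser0 fps1E expr0n.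
  by rewrite gtn_eqF ?sub0r ?opprK // -ltnS prednK ?prime_gt1 ?prime_gt0.
(* Both sides multiplied by [G] give [- A 1]. *)
have EsG : fps_part p E = fps_reflect G.
  apply/eqP; rewrite -subr_eq0; apply/eqP/(fps_lregl G0).
  by rewrite mulrBr GG mulrC EG subrr.
have -> : Ep_sub_sign p = G by rewrite Ep_sub_signE EsG fps_reflectK.
by [].
Qed.

End ModP.

Theorem theorem1p1 (p : nat) (hp : prime p) (hodd : odd p) :
  laguerre_pm1 p (fps_opp (Tser p)) = fps_mul (Ep p) (Ep_sub_sign p) /\
  fps_mul (fps_mul (laguerre_pm1 p (fps_opp (Tser p))) (Tser p)) (Ep_sub p)
    = fps_mul (fps_pow (@fps_X 'F_p) p) (Ep p).
Proof.
have [LE EG] := laguerre_Ep hp hodd.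
split; first exact: LE.
rewrite !fps_mulE fps_oppE fps_powE LE.
rewrite -[Ep_sub p]/(fps_part p (Ep p)) -mulrA mulrAC -mulrA mulrC.
(* Here [X^p = T (- A 1) = T E_0 G], so both sides equal [E_p G T E_0]. *)
rewrite -(opprK (fps_X _ ^+ p)) -Tser_mul_prod // -mulrN -EG; ring.
Qed.
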